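(* Let the birational functional equation $$\widetilde y(w+1)=F_n(\widetilde y(w)),\qquad \widetilde y:\mathbb{C}\to\mathbb{C}^N,\quad w\in\mathbb{C},$$ be given by a birational map $F_n$ of $\mathbb{C}^N$ that is birationally equivalent to a linear-fractional map $F_1$ (the degree-one map of $\mathbb{C}^N$ induced by $z\mapsto Az$ in homogeneous coordinates, with $A$ a complex $(N+1)\times(N+1)$ matrix, $\det A\ne 0$): $F_n=V\circ F_1\circ V^{-1}$ for a birational map $V$ of $\mathbb{C}^N$. Then the general solution of this equation for the function $\widetilde y(w)$ is $$\widetilde y(w)=V(y(w)),$$ where $y(w)$ is given by the formulae $$y_i(w)=\frac{\sum_{l=1}^{N+1}(U^{-1})_{i,l}\,Y_l(w)}{\sum_{l=1}^{N+1}(U^{-1})_{N+1,l}\,Y_l(w)},\qquad i=1,\dots,N,$$ $$Y(w)=\{Y^{(1)}_1(w),\dots,Y^{(1)}_{k_1}(w),\dots,Y^{(r)}_1(w),\dots,Y^{(r)}_{k_r}(w)\},$$ $$Y^{(i)}_l(w)=\Big(\frac{\lambda_i}{\lambda_r}\Big)^{w}\sum_{m=1}^{k_i}C^{(i)}_{l,m}(w)\,I^{(i)}_m(w),\qquad I^{(i)}_l(w+1)=I^{(i)}_l(w),\quad l=1,\dots,k_i,$$ $$C^{(i)}_{l,m}(w)=\frac{\Gamma(w+1)\,\lambda_i^{-(m-l)}}{\Gamma(w+1-m+l)\,\Gamma(m-l+1)},\qquad C^{(i)}_{m,m}\equiv 1,\qquad C^{(i)}_{l,m}\equiv 0\ \text{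 for } l>m,$$ in which $Y^{(r)}_{k_r}(w)$ and $I^{(r)}_{k_r}(w)$ are identically equal to $1$ and the remaining $N$ periodic functions $I^{(i)}_m(w)$ are arbitrary.
   Context: A birational map $F_n$ of $\mathbb{C}^N$ is written $y\mapsto y'$ with $y'_i=f_i(y)/f_{N+1}(y)$, $i=1,\dots,N$, where $f_1,\dots,f_{N+1}$ are polynomials with complex coefficients, and its degree is $n=\max_{1\le i\le N+1}\deg f_i$. A birational map $F_n$ is called birationally equivalent to a birational map $F_{n'}$ if there exists a birational map $V$ with $F_n=V\circ F_{n'}\circ V^{-1}$. With $y_i=z_i/z_{N+1}$, the map $z\mapsto Az$ induces $F_1(y)_i=\big(\sum_{j=1}^{N}A_{i,j}y_j+A_{i,N+1}\big)/\big(\sum_{j=1}^{N}A_{N+1,j}y_j+A_{N+1,N+1}\big)$, $i=1,\dots,N$. The matrix $U$ brings $A$ to Jordan normal form: $D=UAU^{-1}=\mathrm{diag}(D^{(1)},\dots,D^{(r)})$, $r\ge1$, $\dim D^{(i)}=k_i$, $D^{(i)}_{s,t}=\lambda_i\delta_{s,t}+\delta_{s,t-1}$ for $s,t\in\{1,\dots,k_i\}$, $\sum_{i=1}^r k_i=N+1$. The formulae for $y(w)$ give the general solution of $y(w+1)=F_1(y(w))$. $Y_l$, $l=1,\dots,N+1$, denotes the $l$-th entry of $Y$; $\delta$ is the Kronecker delta and $\Gamma$ the Gamma function.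
   Formalization: That every solution has the form V(y(w)) is proved only for solutions in general position: V^{-1} is defined at the solution's values, V is defined at the resulting x, and the last coordinate of U(x,1) is nonzero; otherwise it fails (y=0 for F_1(y)=2y with λ_r=2). *)

(* Defs.v *)
From HB Require Import structures.
From mathcomp Require Import all_boot all_order all_algebra.
From mathcomp Require Import all_classical all_reals all_analysis.
From mathcomp.real_closed Require Import complex.
(* The notations of mpoly clash with those of analysis. *)
From mathcomp.multinomials Require Import -(notations) mpoly.

Set Implicit Arguments.
Unset Strict Implicit.
Unset Printing Implicit Defensive.

Import Order.TTheory GRing.Theory Num.Theory.
Import numFieldNormedType.Exports.

Local Open Scope classical_set_scope.
Local Open Scope complex_scope.
Local Open Scope ring_scope.

(* The complex numbers, seen as a numClosedFieldType so that the topology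
   which analysis puts on every numFieldType is found. *)
Definition Cplx (R : realType) : numClosedFieldType := R[i].

Section RationalMaps.
Variables (R : realType) (N : nat).
Local Notation C := (Cplx R).

(* f_1, ..., f_(N+1): the map y |-> (f_i(y) / f_(N+1)(y))_(i <= N). *)
Definition ratmap := 'I_(N + 1) -> mpoly N C.

Definition degree (f : ratmap) : nat := 
  \max_i \max_(m <- msupp (f i)) mdeg m.

Definition homog (y : 'cV[C]_N) : 'cV[C]_(N + 1) := col_mx y 1%:M.

(* y_i = z_i / z_(N+1); undefined on the hyperplane z_(N+1) = 0. *)
Definition dehomog (z : 'cV[C]_(N + 1)) : option 'cV[C]_N :=
  let d := z (rshift N ord0) ord0 in
  if d == 0 then None else Some (\col_i (z (lshift 1 i) ord0 / d)).

Definition rapp (f : ratmap) (y : 'cV[C]_N) : option 'cV[C]_N :=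
  dehomog (\col_i meval (fun j => y j ord0) (f i)).

(* P holds on a nonempty Zariski open subset of C^N. *)
Definition generically (P : 'cV[C]_N -> Prop) : Prop :=
  exists2 h : mpoly N C, h != 0 &
    forall y : 'cV[C]_N, meval (fun j => y j ord0) h != 0 -> P y.

(* Equality of rational maps: both sides are defined and agree on a common
   nonempty Zariski open set. *)
Definition ratmap_eq (f g : 'cV[C]_N -> option 'cV[C]_N) : Prop :=
  generically (fun y => f y <> None /\ f y = g y).

Definition rcomp (f g : 'cV[C]_N -> option 'cV[C]_N) :=
  fun y => obind f (g y).

Definition inverse_ratmaps (f g : ratmap) : Prop :=
  ratmap_eq (rcomp (rapp f) (rapp g)) Some /\
  ratmap_eq (rcomp (rapp g) (rapp f)) Some.

Definition birational (f : ratmap) : Prop := exists g, inverse_ratmaps f g.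

(* The map induced by z |-> A z in the coordinates y_i = z_i / z_(N+1). *)
Definition linfrac (A : 'M[C]_(N + 1)) : ratmap := fun i =>
  \sum_(j < N) A i (lshift 1 j) *: mpolyX C (mnm1 j)
  + mpolyC N (A i (rshift N ord0)).

(* y restricted to S satisfies y(w + 1) = f(y(w)); the right-hand side is
   required to be defined there. *)
Definition solution_on (S : set C) (f : ratmap) (y : C -> 'cV[C]_N) : Prop :=
  forall w, S w -> rapp f (y w) = Some (y (w + 1)).

End RationalMaps.

Section SpecialFunctions.
Variable R : realType.
Local Notation C := (Cplx R).

Definition cexp (z : C) : C :=
  (expR (complex.Re z))%:C * (cos (complex.Im z) +i* sin (complex.Im z)).

(* An arbitrary (not necessarily continuous) choice of logarithms, only
   normalized by L 1 = 0, so that 1 ^ w = 1. *)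
Definition log_branch (L : C -> C) : Prop :=
  L 1 = 0 /\ forall z, z != 0 -> cexp (L z) = z.

Lemma log_branch_exists : exists L : C -> C, log_branch L.
Proof.
have logE (z : C) : exists v, z != 0 -> cexp v = z /\ (z = 1 -> v = 0).
  have [->|z1] := eqVneq z 1.
    exists 0 => _; split=> //; rewrite /cexp /= expR0 cos0 sin0.
    by apply/eqP; rewrite eq_complex /= !(mul0r, mulr0, mul1r, subr0, addr0) !eqxx.
  case: z z1 => a b z1; pose rho := Num.sqrt (a ^+ 2 + b ^+ 2).
  pose t := acos (a / rho).
  exists (ln rho +i* (if 0 <= b then t else - t)) => z0.
  have ab0 : 0 < a ^+ 2 + b ^+ 2.
    rewrite lt_neqAle addr_ge0 ?sqr_ge0 // andbT eq_sym paddr_eq0 ?sqr_ge0 //.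
    by rewrite !sqrf_eq0; move: z0; rewrite eq_complex /=.
  have rho0 : 0 < rho by rewrite sqrtr_gt0.
  have rho2 : rho ^+ 2 = a ^+ 2 + b ^+ 2 by rewrite sqr_sqrtr // ltW.
  have sq1 : 1 - (a / rho) ^+ 2 = (`|b| / rho) ^+ 2.
    rewrite !expr_div_n rho2 real_normK ?num_real //.
    apply: (mulIf (lt0r_neq0 ab0)).
    by rewrite mulrBl !divfK ?lt0r_neq0 // mul1r addrC addKr.
  have c1 : -1 <= a / rho <= 1.
    rewrite -ler_norml -(ler_pXn2r (n := 2)) ?nnegrE //.
    by rewrite real_normK ?num_real // expr1n -subr_ge0 sq1 sqr_ge0.
  have cosE : cos t = a / rho by rewrite acosK // in_itv.
  have sinE : sin t = `|b| / rho.
    by rewrite sin_acos // sq1 sqrtr_sqr ger0_norm // divr_ge0 ?normr_ge0 // ltW.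
  split; last by move=> z1'; rewrite z1' eqxx in z1.
  rewrite /cexp /= lnK // ; apply/eqP; rewrite eq_complex /= !mul0r subr0 addr0.
  have r0 := lt0r_neq0 rho0.
  case: (leP 0 b) => b0.
    by rewrite cosE sinE ger0_norm // !(mulrC rho) !divfK // !eqxx.
  by rewrite cosN sinN cosE sinE ltr0_norm // mulNr opprK !(mulrC rho) !divfK // !eqxx.
have [L LE] := choice logE.
by exists L; split=> [|z z0]; [apply: (LE 1 _).2; rewrite ?oner_neq0 | apply: (LE z z0).1].
Qed.

Definition cpow (L : C -> C) (a w : C) : C := cexp (w * L a).

(* Euler's limit n! n^z / (z (z + 1) ... (z + n)); the value at the poles
   0, -1, -2, ... is irrelevant. *)
Definition Gamma (z : C) : C :=
  lim ((n`!%:R * cexp (z * (ln n%:R)%:C)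
        / \prod_(0 <= j < n.+1) (z + j%:R)) @[n --> \oo]).

End SpecialFunctions.

Section GeneralSolution.
Variables (R : realType) (N : nat).
Local Notation C := (Cplx R).

Definition Jordan_block (n : nat) (a : C) : 'M[C]_n :=
  \matrix_(s, t) (a *+ (s == t) + (s.+1 == t :> nat)%:R).

(* The quotient of Gamma functions is taken as a meromorphic function of w:
   its removable singularities (at negative integers) are filled by the limit
   over the punctured neighbourhoods of w.  Indices start at 0; only the
   difference m - l matters. *)
Definition Ccoef (a : C) (l m : nat) (w : C) : C :=
  if (l < m)%N then
    lim ((Gamma (v + 1) * a ^- (m - l)
          / (Gamma (v + 1 - m%:R + l%:R) * Gamma (m%:R - l%:R + 1)))
         @[v --> w^'])
  else (l == m)%:R.

(* There are r.+1 >= 1 Jordan blocks, the last one having index ord_max. *)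
Variables (L : C -> C) (r : nat) (k : 'I_r.+1 -> nat) (lam : 'I_r.+1 -> C).

Definition periodic_data := forall i : 'I_r.+1, 'I_(k i) -> C -> C.

(* l.+1 = k ord_max singles out the last index of the last block. *)
Definition admissible (I : periodic_data) : Prop :=
  (forall i l w, I i l (w + 1) = I i l w) /\
  (forall l : 'I_(k ord_max), l.+1 = k ord_max -> forall w, I ord_max l w = 1).

Definition Yblock (I : periodic_data) (w : C) (i : 'I_r.+1) : 'cV[C]_(k i) :=
  \col_l (cpow L (lam i / lam ord_max) w
          * \sum_(m < k i) Ccoef (lam i) l m w * I i m w).

Definition Yvec (hk : (\sum_i k i)%N = (N + 1)%N) (I : periodic_data) (w : C) :
    'cV[C]_(N + 1) :=
  castmx (hk, erefl 1%N) (\mxcol_i Yblock I w i).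

(* y(w), undefined where the common denominator vanishes. *)
Definition ysol (hk : (\sum_i k i)%N = (N + 1)%N) (U : 'M[C]_(N + 1))
    (I : periodic_data) (w : C) : option 'cV[C]_N :=
  dehomog (invmx U *m Yvec hk I w).

End GeneralSolution.

(* General position of a point p with respect to the parametrization: p = V(x)
   with x = V^-1(p), and the coordinate of U (x, 1) which is normalized to 1
   in Y does not vanish.  This excludes a proper algebraic subset of C^N. *)
Definition general_position (R : realType) (N : nat) (V Vinv : ratmap R N)
    (U : 'M[Cplx R]_(N + 1)) (p : 'cV[Cplx R]_N) : Prop :=
  exists x, [/\ rapp Vinv p = Some x, rapp V x = Some p &
    (U *m homog x) (rshift N ord0) ord0 != 0].

(* Main.v *)
(* An equality of rational maps holds, after clearing denominators, as a
   polynomial identity; hence F o V = V o F_1 and V^-1 o F o V = F_1, which are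
   only known on a Zariski open set, hold at every point where both sides are
   defined.  This reduces the equation to Y(w + 1) = D Y(w) / lambda_r in the
   Jordan coordinates, the factor 1 / lambda_r normalizing the last coordinate
   to 1.  Euler's product converges to a nonzero value off the poles (successive
   terms have ratio 1 + O(1 / n^2)), so the quotients of Gamma functions are the
   binomial coefficients binom(w, m - l), and Pascal's rule says that the
   unitriangular matrix C(w) satisfies lambda C(w + 1) = J C(w) for the Jordan
   block J.  Since C(w) is invertible, the periodic functions of a given
   solution are recovered as I(w) = (lambda / lambda_r)^-w C(w)^-1 Y(w). *)

Require Import Defs.
From mathcomp Require Import all_boot all_order all_algebra.
From mathcomp Require Import all_classical all_reals all_analysis.
From mathcomp.real_closed Require Import complex.
From mathcomp Require Import ring lra.
From mathcomp.multinomials Require Import -(notations) mpoly.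
Set Implicit Arguments.
Unset Strict Implicit.
Unset Printing Implicit Defensive.
Import Order.TTheory GRing.Theory Num.Theory.
Import numFieldNormedType.Exports.
Local Open Scope classical_set_scope.
Local Open Scope ring_scope.

(** * Detecting nonzero polynomials by evaluation *)

Lemma meval_muni (K : comNzRingType) (n : nat) (p : mpoly n.+1 K) (v : 'I_n.+1 -> K) :
  meval v p =
  (map_poly (meval (fun i => v (widen_ord (leqnSn n) i))) (muni p)).[v ord_max].
Proof.
rewrite muniE mevalE rmorph_sum horner_sum; apply: eq_bigr => m _.
rewrite /= map_polyZ map_polyXn hornerZ hornerXn /= mevalZ mevalX big_ord_recr /= mulrA.
by congr (_ * _ * _); apply: eq_bigr => i _; rewrite mnmE.
Qed.

(** A monomial is determined by its exponent in the last variable and its remaining exponents, so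
    each coefficient of [p] reappears inside exactly one coefficient of [muni p]. *)
Lemma muni_eq0 (K : comNzRingType) (n : nat) (p : mpoly n.+1 K) : muni p = 0 -> p = 0.
Proof.
move=> p0; apply/mpolyP => m; rewrite mcoeff0.
have [m_in|/memN_msupp_eq0//] := boolP (m \in msupp p).
pose m' : multinom n := Multinom [tuple m (widen_ord (leqnSn n) i) | i < n].
have := congr1 (fun q : {poly mpoly n K} => mcoeff m' q`_(m ord_max)) p0.
rewrite muniE coef_sum raddf_sum coef0 mcoeff0 (bigD1_seq m) ?msupp_uniq //=.
rewrite coefZ coefXn eqxx mulr1 mcoeffZ mcoeffX eqxx mulr1 big1 ?addr0 // => k km.
rewrite coefZ coefXn; case: eqP => [e|_]; last by rewrite mulr0 mcoeff0.
rewrite mulr1 mcoeffZ mcoeffX; case: eqP => [e'|_]; last by rewrite mulr0.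
case/eqP: km; apply/mnmP => i.
have [j ->|->] := unliftP ord_max i; last by rewrite e.
have -> : lift ord_max j = widen_ord (leqnSn n) j.
  by apply/val_inj; rewrite /= /bump leqNgt ltn_ord.
by have := congr1 (fun q : multinom n => q j) e'; rewrite !mnmE.
Qed.

(** Induction on the number of variables. With the other variables fixed, a polynomial vanishing
    everywhere has all natural numbers as roots in the last one; these are distinct in
    characteristic zero, hence too many. *)
Lemma mpoly_neq0_meval (K : numDomainType) (n : nat) (p : mpoly n K) :
  p != 0 -> exists v, meval v p != 0.
Proof.
move=> p0; apply/not_existsP => pv; move/eqP: p0; apply.
have {}pv v : meval v p = 0 by apply/eqP/negbNE/negP/pv.
elim: n p pv => [|n IHn] p pv.
  by have := pv (fun=> 0); rewrite (nvar0_mpolyC p) mevalC => ->; rewrite mpolyC0.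
apply: muni_eq0; apply/polyP => i; rewrite coef0; apply: IHn => v.
set q := map_poly (meval v) (muni p).
suff q0 : q = 0 by rewrite -[meval v _]/(meval v _) -(coef_map (meval v)) -/q q0 coef0.
apply/eqP/negPn/negP => q0.
have /(max_poly_roots q0) : all (root q) [seq j%:R | j <- iota 0 (size q)].
  apply/allP => x _; apply/rootP.
  pose w (i : 'I_n.+1) := if unlift ord_max i is Some j then v j else x.
  rewrite -(pv w) meval_muni /w unlift_none.
  congr (_.[_]); apply: eq_map_poly => s; apply: meval_eq => j.
  have -> : widen_ord (leqnSn n) j = lift ord_max j.
    by apply/val_inj; rewrite /= /bump leqNgt ltn_ord.
  by rewrite liftK.
rewrite map_inj_uniq ?iota_uniq ?size_map ?size_iota ?ltnn; first by move/(_ isT).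
by move=> a b /eqP; rewrite eqr_nat => /eqP.
Qed.

(** * Pointwise composition and identity of rational maps *)

Section RationalMaps.
Variables (R : realType) (N : nat).
Local Notation C := (Cplx R).
Local Notation ev y h := (meval (fun j => y j ord0) h).
Implicit Types (f g : ratmap R N) (x y p q : 'cV[C]_N) (z : 'cV[C]_(N + 1)).

Lemma homogE y : homog y (rshift N ord0) ord0 = 1.
Proof. by rewrite /homog col_mxEd mxE. Qed.

Lemma homogEl y j : homog y (lshift 1 j) ord0 = y j ord0.
Proof. by rewrite /homog col_mxEu. Qed.

(** This form trades partial maps and quotients for proportionality of homogeneous vectors with a
    nonzero factor. *)
Lemma dehomogP z y :
  dehomog z = Some y <-> exists2 c, c != 0 & z = c *: homog y.
Proof.
rewrite /dehomog; split=> [|[c c0 ->]].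
  case: eqP => // /eqP d0 [<-]; exists (z (rshift N ord0) ord0) => //.
  apply/colP => i; rewrite mxE; case: (split_ordP i) => j ->.
    by rewrite homogEl mxE mulrC divfK.
  by rewrite ord1 homogE mulr1.
rewrite mxE homogE mulr1 (negPf c0); congr Some; apply/colP => i.
by rewrite mxE [X in X / _ = _]mxE homogEl mulrC mulKf.
Qed.

Lemma dehomogZ c z : c != 0 -> dehomog (c *: z) = dehomog z.
Proof.
move=> c0; rewrite /dehomog mxE mulf_eq0 (negPf c0) /=.
case: eqP => // _; congr Some; apply/colP => i; rewrite !mxE.
by rewrite -mulf_div divff // mul1r.
Qed.

Lemma homog_neq0 y : homog y != 0.
Proof.
apply/eqP => /(congr1 (fun z : 'cV_(N + 1) => z (rshift N ord0) ord0)) /eqP.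
by rewrite homogE mxE oner_eq0.
Qed.

(** The homogeneous value before division: it is defined everywhere and vanishes exactly at the
    common zeros of the components. *)
Definition rvec f y : 'cV[C]_(N + 1) := \col_i ev y (f i).

Lemma rvecE f y i : rvec f y i ord0 = ev y (f i). Proof. by rewrite mxE. Qed.

Lemma rvec_scale f x y c : rvec f x = c *: homog y ->
  ev x (f (rshift N ord0)) = c /\ forall j, ev x (f (lshift 1 j)) = c * y j ord0.
Proof.
move=> /colP fx; split=> [|j]; rewrite -rvecE fx mxE ?homogE ?mulr1 //.
by rewrite homogEl.
Qed.

Lemma rappE f y : rapp f y = dehomog (rvec f y). Proof. by []. Qed.

Lemma rappP f y x :
  rapp f y = Some x <-> exists2 c, c != 0 & rvec f y = c *: homog x.
Proof. exact: dehomogP. Qed.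

(* Each monomial of f is homogenized by a power of the denominator of g. *)
Lemma ratmap_comp f g : exists h (d : nat), forall x y c,
  rvec g x = c *: homog y -> rvec h x = c ^+ d *: rvec f y.
Proof.
pose d := (\sum_i msize (f i))%N.
exists (fun i => \sum_(m <- msupp (f i)) mcoeff m (f i) *:
    ((\prod_(j < N) g (lshift 1 j) ^+ m j) * g (rshift N ord0) ^+ (d - mdeg m))), d.
move=> x y c /rvec_scale[gl gx]; apply/colP => i.
rewrite !mxE raddf_sum (mevalE _ (f i)) mulr_sumr.
rewrite big_seq [RHS]big_seq; apply: eq_bigr => m m_in.
have md : (mdeg m <= d)%N.
  by rewrite /d (bigD1 i) //= (leq_trans (ltnW (msize_mdeg_lt m_in))) ?leq_addr.
rewrite /= mevalZ mevalM rmorph_prod rmorphXn /=.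
rewrite gl; under eq_bigr => j _ do rewrite rmorphXn /= gx exprMn.
rewrite big_split /= prodrXr -mdegE -[in RHS](subnKC md) exprD.
have swap (a b e e' : C) : a * (b * e * e') = b * e' * (a * e) by ring.
exact: swap.
Qed.

(** Clearing denominators costs a factor [c ^+ d], which is nonzero wherever [g] is defined and so
    disappears on dehomogenizing. *)
Lemma rapp_comp f g : exists h,
  forall x y, rapp g x = Some y -> rapp h x = rapp f y.
Proof.
have [h [d hE]] := ratmap_comp f g; exists h => x y /rappP[c c0 /hE e].
by rewrite rappE e dehomogZ // expf_neq0.
Qed.

Lemma generically_ex (P : 'cV[C]_N -> Prop) : generically P -> exists x, P x.
Proof.
move=> [h /mpoly_neq0_meval[v hv] hP]; exists (\col_i v i); apply: hP.
by rewrite (meval_eq (v2 := v)) // => i; rewrite mxE.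
Qed.

Lemma generically_imp (P Q : 'cV[C]_N -> Prop) :
  (forall x, P x -> Q x) -> generically P -> generically Q.
Proof. by move=> PQ [h h0 hP]; exists h => // y /hP /PQ. Qed.

Lemma generically_and (P Q : 'cV[C]_N -> Prop) :
  generically P -> generically Q -> generically (fun x => P x /\ Q x).
Proof.
move=> [h h0 hP] [k k0 kQ]; exists (h * k) => [|y]; first by rewrite mulf_neq0.
by rewrite mevalM mulf_eq0 negb_or => /andP[/hP ? /kQ ?].
Qed.

Lemma generically_meval0 (h : mpoly N C) :
  generically (fun x => ev x h = 0) -> h = 0.
Proof.
move=> hP; apply/eqP/negPn/negP => h0.
have /(generically_and hP)/generically_ex[x [-> /eqP//]] :
  generically (fun x => ev x h != 0) by exists h.
Qed.

(** The cross-multiplied identities hold generically, hence everywhere. At [x] they make [rvec g x]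
    proportional to [homog y]; it suffices that [x] is not a common zero of the components of
    [g]. *)
Lemma ratmap_eq_point f g x y : ratmap_eq (rapp f) (rapp g) ->
  rapp f x = Some y -> rvec g x != 0 -> rapp g x = Some y.
Proof.
move=> fg /rappP[c c0 fx] gx0.
pose l := rshift N (ord0 : 'I_1).
have cross i : f i * g l = g i * f l.
  apply/eqP; rewrite -subr_eq0; apply/eqP/generically_meval0.
  move: fg; apply: generically_imp => t [ft gt].
  case ft' : (rapp f t) ft gt => [u|//] _ /esym gt; move: ft' => ft.
  move/rappP: gt => [b b0 gt]; move/rappP: ft => [a a0 ft].
  rewrite mevalB !mevalM (rvec_scale gt).1 (rvec_scale ft).1 -!rvecE gt ft !mxE.
  by ring.
have gE : rvec g x = rvec g x l ord0 *: homog y.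
  apply/colP => i; rewrite [RHS]mxE !rvecE.
  have := congr1 (fun h => ev x h) (cross i).
  rewrite !mevalM (rvec_scale fx).1 -(rvecE f) fx mxE.
  by move=> e; apply: (mulfI c0); rewrite [LHS]mulrC -e mulrA mulrAC.
apply/rappP; exists (rvec g x l ord0) => //.
by apply: contraNneq gx0 => g0; rewrite gE g0 scale0r.
Qed.

(** Zariski density of the image, phrased with test polynomials: the image lies in no
    hypersurface. *)
Definition dominant g := forall h : mpoly N C, h != 0 ->
  exists x y, rapp g x = Some y /\ ev y h != 0.

(** The new test polynomial is [h] composed with [g], denominators cleared, times the denominator of
    [g], which guarantees definedness. Dominance makes it nonzero. *)
Lemma generically_pullback g (P : 'cV[C]_N -> Prop) : dominant g -> generically P ->
  generically (fun x => exists2 y, rapp g x = Some y & P y).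
Proof.
move=> gdom [h h0 hP].
pose l := rshift N (ord0 : 'I_1).
(* The constant tuple makes the composition of maps apply to the single polynomial [h]. *)
have [H [d HE]] := ratmap_comp (fun=> h) g.
have {}HE x y c : rvec g x = c *: homog y ->
    ev x (H l * g l) = c ^+ d.+1 * ev y h.
  move=> e; have := congr1 (fun z : 'cV_(N + 1) => z l ord0) (HE _ _ _ e).
  rewrite [RHS]mxE !rvecE mevalM => ->; rewrite (rvec_scale e).1.
  by rewrite exprSr mulrAC.
exists (H l * g l) => [|x].
  have [x [y [/rappP[c c0 /HE gx] hy]]] := gdom h h0.
  apply/eqP => H0; move: gx; rewrite H0 meval0 => /eqP.
  by rewrite eq_sym mulf_eq0 expf_eq0 (negPf c0) (negPf hy).
have [gx0|gx0] := eqVneq (ev x (g l)) 0; first by rewrite mevalM gx0 mulr0 eqxx.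
case E : (rapp g x) => [y|]; last first.
  by move: E; rewrite rappE /dehomog mxE (negPf gx0).
have /rappP[c c0 /HE ->] := E.
by rewrite mulf_eq0 negb_or => /andP[_ /hP ?]; exists y.
Qed.

(** A generic point [p] is the value of [f] at [g p]. *)
Lemma inverse_dominant f g : inverse_ratmaps f g -> dominant f.
Proof.
move=> [fgK _] h h0.
have /(generically_and fgK)/generically_ex[p [[_ e] hp]] :
  generically (fun x => ev x h != 0) by exists h.
by move: e; rewrite /rcomp; case: (rapp g p) => //= x fx; exists x, p.
Qed.

Lemma rvec_linfrac (A : 'M[C]_(N + 1)) x : rvec (linfrac A) x = A *m homog x.
Proof.
apply/colP => i; rewrite rvecE /linfrac mevalD mevalC [RHS]mxE big_split_ord /= big_ord1.
rewrite homogE mulr1 raddf_sum; congr (_ + _).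
by apply: eq_bigr => j _; rewrite /= mevalZ mevalXU homogEl.
Qed.

(** A preimage of [y] is obtained from the inverse matrix, provided the last coordinate of
    [invmx A *m homog y] does not vanish; the test polynomial is multiplied by this coordinate. *)
Lemma linfrac_dominant (A : 'M[C]_(N + 1)) : A \in unitmx -> dominant (linfrac A).
Proof.
move=> uA h h0; pose l := rshift N (ord0 : 'I_1).
(* Otherwise, evaluating at 0 and at the basis vectors shows that the last row of [invmx A] is
   zero. *)
have p0 : linfrac (invmx A) l != 0.
  apply/eqP => p0.
  have row0 y : (invmx A *m homog y) l ord0 = 0.
    by rewrite -rvec_linfrac rvecE p0 meval0.
  have l0 : invmx A l l = 0.
    have := row0 0; rewrite mxE big_split_ord big_ord1 /= homogE mulr1 big1 ?add0r //.
    by move=> j _; rewrite homogEl mxE mulr0.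
  have : row l (invmx A) = 0.
    apply/rowP => i; rewrite !mxE; case: (split_ordP i) => j ->; last by rewrite ord1.
    have := row0 (delta_mx j ord0).
    rewrite mxE big_split_ord big_ord1 /= -/l l0 mul0r addr0 (bigD1 j) //= big1 => [|k kj].
      by rewrite homogEl mxE !eqxx mulr1 addr0.
    by rewrite homogEl mxE (negPf kj) mulr0.
  rewrite rowE => /(congr1 (mulmx^~ A)); rewrite /= mulmxKV // mul0mx.
  by move=> /matrixP/(_ ord0 l)/eqP; rewrite !mxE !eqxx oner_eq0.
have : h * linfrac (invmx A) l != 0 by rewrite mulf_neq0.
move=> /mpoly_neq0_meval[v]; pose y : 'cV[C]_N := \col_i v i.
rewrite -(meval_eq (v1 := fun i => y i ord0)) => [|i]; last by rewrite mxE.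
rewrite mevalM mulf_eq0 negb_or => /andP[hy ly].
have c0 : (invmx A *m homog y) l ord0 != 0 by rewrite -rvec_linfrac rvecE.
case E : (dehomog (invmx A *m homog y)) => [x|]; last first.
  by move: E; rewrite /dehomog (negPf c0).
have /dehomogP[c c1 e] := E.
exists x, y; split=> //; apply/rappP; rewrite rvec_linfrac.
exists c^-1; first by rewrite invr_eq0.
by rewrite -[homog y](mulKVmx uA) e -scalemxAr scalerA mulVf // scale1r.
Qed.

(** * The conjugation relation at individual points *)

Section Conjugation.
Variables (F V Vinv : ratmap R N) (A : 'M[C]_(N + 1)).
Hypotheses (hV : inverse_ratmaps V Vinv) (uA : A \in unitmx).
Hypothesis hF : ratmap_eq (rapp F)
  (rcomp (rapp V) (rcomp (rapp (linfrac A)) (rapp Vinv))).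

(** Pull the relation for [F] back along the dominant map [V] and cancel [Vinv] after [V]. *)
Lemma generically_semiconj : generically (fun x => exists p x' q,
  [/\ rapp V x = Some p, rapp (linfrac A) x = Some x', rapp V x' = Some q
    & rapp F p = Some q]).
Proof.
have := generically_and (generically_pullback (inverse_dominant hV) hF) hV.2.
apply: generically_imp => x [[p Vx [F0]]]; rewrite /rcomp Vx /= => FE [_ VK].
move: FE; rewrite VK /=; case: (rapp (linfrac A) x) => [x'|] /= FE.
  case E' : (rapp V x') FE F0 => [q|] FE F0; last by rewrite FE in F0.
  by exists p, x', q; exact: And4 erefl erefl E' FE.
by rewrite FE in F0.
Qed.

Lemma semiconj_point x p x' q : rapp V x = Some p -> rapp (linfrac A) x = Some x' ->
  rapp V x' = Some q -> rapp F p <> None -> rapp F p = Some q.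
Proof.
move=> Vx Ax Vx' F0.
have [FV FVE] := rapp_comp F V; have [VA VAE] := rapp_comp V (linfrac A).
rewrite -(FVE _ _ Vx); apply: (@ratmap_eq_point VA).
- move: generically_semiconj; apply: generically_imp => t [p' [t' [q' [Vt At Vt' Fp]]]].
  by rewrite (FVE _ _ Vt) (VAE _ _ At) Vt' Fp.
- by rewrite (VAE _ _ Ax).
(* A zero homogeneous value would leave [F] undefined at [p]. *)
apply/eqP => e; apply: F0; rewrite -(FVE _ _ Vx).
by rewrite rappE e /dehomog mxE eqxx.
Qed.

(** Here [Vinv] after [F] after [V] is compared with the linear map. Cancelling [Vinv] after [V] at
    the image of the linear map uses that this map is dominant; its homogeneous value never vanishes
    because [A] is invertible. *)
Lemma semiconj_inv_point x p q x' : rapp V x = Some p -> rapp F p = Some q ->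
  rapp Vinv q = Some x' -> rapp (linfrac A) x = Some x'.
Proof.
move=> Vx Fp Vq.
have [FV FVE] := rapp_comp F V; have [W WE] := rapp_comp Vinv FV.
apply: (@ratmap_eq_point W).
- have := generically_and generically_semiconj
    (generically_pullback (linfrac_dominant uA) hV.2).
  apply: generically_imp => t [[p' [t' [q' [Vt At Vt' Ft]]]] [t'' At'' [_]]].
  move: At''; rewrite At => -[<-]; rewrite /rcomp Vt' /= => Vq'.
  by rewrite (WE _ q') ?(FVE _ _ Vt) // Vq'.
- by rewrite (WE _ q (etrans (FVE _ _ Vx) Fp)).
rewrite rvec_linfrac; apply/eqP => e; have /eqP := homog_neq0 x; apply.
by rewrite -[homog x](mulKmx uA) e mulmx0.
Qed.

End Conjugation.
End RationalMaps.

(** * Euler's product for the Gamma function *)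

Section ComplexExponential.
Local Open Scope complex_scope.
Local Open Scope ring_scope.
Variable R : realType.
Local Notation C := (Cplx R).
Local Notation nm := (@ComplexField.Normc.normc R).
Implicit Types (x y : R) (z : C).

(** The exponential is squeezed between [1 + x] and the inverse of [1 - x]. *)
Lemma expR_sub1x_le x : `|x| <= 1 / 2 -> `|expR x - 1 - x| <= 2 * x ^+ 2.
Proof.
rewrite ler_norml => /andP[xl xu].
have le1 : 1 + x <= expR x := expR_ge1Dx x.
have : (1 - x) * expR x <= 1.
  have := ler_wpM2r (expR_ge0 x) (expR_ge1Dx (- x)).
  by rewrite [leRHS]mulrC expRxMexpNx_1.
move=> le2; rewrite ger0_norm; last by lra.
by nra.
Qed.

Lemma sin_norm_le x : `|sin x| <= `|x|.
Proof.
wlog x0 : x / 0 <= x => [hw|].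
  have [/hw//|/ltW x0] := leP 0 x; rewrite -normrN -sinN -(normrN x).
  by rewrite hw // oppr_ge0.
have ct : {within `[0, x], continuous (@sin R)}.
  by apply: continuous_subspaceT; exact: continuous_sin.
have [c _] := MVT_segment x0 (fun y _ => is_derive_sin y) ct.
by rewrite sin0 !subr0 => ->; rewrite normrM ler_piMl // cos_max.
Qed.

Lemma cos_sub1E x : cos x - 1 = - (2 * sin (x / 2) ^+ 2).
Proof.
have {1}-> : x = (x / 2) *+ 2 by rewrite -mulr_natr divfK // pnatr_eq0.
by rewrite cos_mulr2n cos2sin2; ring.
Qed.

Lemma cos_sub1_le x : `|cos x - 1| <= x ^+ 2.
Proof.
rewrite cos_sub1E normrN ger0_norm; last by rewrite mulr_ge0 // sqr_ge0.
have := sin_norm_le (x / 2); rewrite -ler_sqr ?nnegrE ?normr_ge0 //.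
by rewrite !real_normK ?num_real //; nra.
Qed.

(** Mean value theorem: the derivative [cos c - 1] equals minus twice the square of [sin (c / 2)],
    which is at most [c] in absolute value for [0 <= c]. *)
Lemma sin_subx_le x : `|sin x - x| <= x ^+ 2.
Proof.
wlog x0 : x / 0 <= x => [hw|].
  have [/hw//|/ltW x0] := leP 0 x; rewrite -normrN -sqrrN.
  by rewrite opprD -sinN hw // oppr_ge0.
have ct : {within `[0, x], continuous (fun y => sin y - y)}.
  apply: continuous_subspaceT => y.
  by apply: cvgB; [exact: continuous_sin|exact: cvg_id].
have dr y : is_derive y 1 (fun y => sin y - y) (cos y - 1) by exact: is_deriveB.
have [c] := MVT_segment x0 (fun y _ => dr y) ct.
rewrite in_itv /= => /andP[c0 cx]; rewrite sin0 !subr0 => ->.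
rewrite normrM (ger0_norm x0) expr2 ler_wpM2r //.
rewrite cos_sub1E normrN ger0_norm; last by rewrite mulr_ge0 // sqr_ge0.
have := sin_norm_le (c / 2); rewrite (@ger0_norm _ (c / 2)) ?divr_ge0 //.
have := sin_le1 (c / 2); have := sin_geN1 (c / 2).
by rewrite ler_norml; nra.
Qed.

Lemma cexpD (a b : C) : cexp (a + b) = cexp a * cexp b.
Proof.
case: a b => [a a'] [b b']; rewrite /cexp /= expRD cosD sinD.
by apply/eqP; rewrite eq_complex /=; apply/andP; split; apply/eqP; ring.
Qed.

Lemma cexp0 : cexp (0 : C) = 1.
Proof.
by rewrite /cexp /= expR0 cos0 sin0; apply/eqP; rewrite eq_complex /=;
  apply/andP; split; apply/eqP; ring.
Qed.

Lemma cexp_neq0 (a : C) : cexp a != 0.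
Proof.
apply/eqP => a0; have /eqP := cexp0.
by rewrite -(subrr a) cexpD a0 mul0r eq_sym oner_eq0.
Qed.

Lemma cexp_ln x : 0 < x -> cexp ((ln x)%:C : C) = x%:C.
Proof.
move=> x0; rewrite /cexp /= lnK // cos0 sin0.
by apply/eqP; rewrite eq_complex /=; apply/andP; split; apply/eqP; ring.
Qed.

Lemma normc_Re_le z : `|complex.Re z| <= nm z.
Proof.
case: z => a b /=; rewrite -sqrtr_sqr ler_wsqrtr // lerDl sqr_ge0 //.
Qed.

Lemma normc_Im_le z : `|complex.Im z| <= nm z.
Proof.
case: z => a b /=; rewrite -sqrtr_sqr ler_wsqrtr // lerDr sqr_ge0 //.
Qed.

Lemma normc_le_ReIm z : nm z <= `|complex.Re z| + `|complex.Im z|.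
Proof.
case: z => a b /=.
rewrite -[leRHS]ger0_norm ?addr_ge0 // -sqrtr_sqr ler_wsqrtr //.
rewrite -(real_normK (num_real a)) -(real_normK (num_real b)).
by have := normr_ge0 a; have := normr_ge0 b; nra.
Qed.

Lemma normc_sqr z : nm z ^+ 2 = complex.Re z ^+ 2 + complex.Im z ^+ 2.
Proof. by case: z => a b /=; rewrite sqr_sqrtr // addr_ge0 ?sqr_ge0. Qed.

(** The real and imaginary parts of the remainder are bounded by [2 u^2 + 2 v^2] and
    [4 u^2 + 3 v^2]; the constant 8 covers their sum. *)
Lemma cexp_sub1z_le z : nm z <= 1 / 2 -> nm (cexp z - 1 - z) <= 8 * nm z ^+ 2.
Proof.
move=> z2; apply: (le_trans (normc_le_ReIm _)); rewrite normc_sqr.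
have := le_trans (normc_Re_le z) z2; case: z z2 => u v _ /= u2.
have := expR_sub1x_le u2; have := cos_sub1_le v; have := sin_subx_le v.
have := cos_max v; have := sin_max v.
set E := expR u; set c := cos v; set s := sin v => s1 c1 sv cv eu.
have -> : E * c - 0 * s - 1 - u = (E - 1 - u) * c + (1 + u) * (c - 1) by ring.
have -> : E * s + 0 * c - 0 - v = (E - 1 - u) * s + u * s + (s - v) by ring.
have b1 : `|(E - 1 - u) * c + (1 + u) * (c - 1)| <= 2 * u ^+ 2 + 2 * v ^+ 2.
  apply: le_trans (ler_normD _ _) _; rewrite !normrM; apply: lerD.
    by rewrite -[leRHS]mulr1 ler_pM.
  apply: ler_pM => //; move: u2; rewrite !ler_norml; lra.
have b2 : `|(E - 1 - u) * s + u * s + (s - v)| <= 4 * u ^+ 2 + 3 * v ^+ 2.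
  have ss : `|s| <= `|v| := sin_norm_le v.
  have e1 : `|E - 1 - u| * `|s| <= 2 * u ^+ 2 by rewrite -[leRHS]mulr1 ler_pM.
  have e2 : `|u| * `|s| <= u ^+ 2 + v ^+ 2.
    have := ler_wpM2l (normr_ge0 u) ss; have := sqr_ge0 (`|u| - `|v|).
    rewrite -(real_normK (num_real u)) -(real_normK (num_real v)).
    by have := normr_ge0 u; have := normr_ge0 v; nra.
  have t1 := ler_normD ((E - 1 - u) * s + u * s) (s - v).
  have t2 := ler_normD ((E - 1 - u) * s) (u * s); rewrite !normrM in t2.
  by have := sqr_ge0 u; have := sqr_ge0 v; lra.
by have := sqr_ge0 u; have := sqr_ge0 v; lra.
Qed.

End ComplexExponential.

(** * Convergence of complex sequences through real estimates *)

Section ComplexSequences.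
Local Open Scope complex_scope.
Local Open Scope ring_scope.
Variable R : realType.
Local Notation C := (Cplx R).
Local Notation nm := (@ComplexField.Normc.normc R).
Implicit Types (u : nat -> C) (l z : C).

Lemma normc_ge0 z : 0 <= nm z.
Proof. by case: z => a b; rewrite /= sqrtr_ge0. Qed.

Lemma normc_eq0 z : (nm z == 0) = (z == 0).
Proof.
apply/eqP/eqP => [|->]; first exact: ComplexField.Normc.eq0_normc.
exact: ComplexField.Normc.normc0.
Qed.

Lemma normc_gt0 z : (0 < nm z) = (z != 0).
Proof. by rewrite lt0r normc_eq0 normc_ge0 andbT. Qed.

Lemma normc_distC (a b : C) : nm (a - b) = nm (b - a).
Proof. by rewrite -opprB normcN. Qed.

Lemma normc_real (x : R) : nm x%:C = `|x|.
Proof. by rewrite /= expr0n addr0 sqrtr_sqr. Qed.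

Lemma normc_nat n : nm (n%:R : C) = n%:R.
Proof. by rewrite -(rmorph_nat (real_complex R)) normc_real ger0_norm. Qed.

(** The norm of [C] takes values in [C] itself; the real-valued modulus allows real inequalities to
    be used. *)
Lemma cvgC_normcP u l : u @ \oo --> l <->
  forall e : R, 0 < e -> exists n0, forall n, (n0 <= n)%N -> nm (u n - l) <= e.
Proof.
split=> [/cvgrPdist_le ul e e0|ul].
  have /ul [n0 _ hn] : 0 < (e%:C : C) by rewrite ltcR.
  by exists n0 => n /hn; rewrite -[`|_|]/((nm _)%:C) lecR normc_distC.
apply/cvgrPdist_le => e e0.
have eE : e = (complex.Re e)%:C by rewrite RRe_real // gtr0_real.
have /ul[n0 hn] : 0 < complex.Re e by rewrite -ltcR -eE.
exists n0 => // n /hn; rewrite normc_distC => h.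
by rewrite -[`|_|]/((nm _)%:C) eE lecR.
Qed.

Lemma cauchyR_cvg (a : nat -> R) :
  (forall e, 0 < e -> exists n0, forall n, (n0 <= n)%N -> `|a n - a n0| <= e) ->
  cvg (a @ \oo).
Proof.
move=> ca; apply/cauchy_cvgP/cauchy_exP => e e0.
have [n0 hn] := ca (e / 2) (divr_gt0 e0 (ltr0n _ 2)).
exists (a n0); exists n0 => // n /= /hn h; rewrite /ball /= distrC.
by apply: le_lt_trans h _; rewrite ltr_pdivrMr ?ltr0n // ltr_pMr // ltr1n.
Qed.

Lemma cauchyC_cvg u :
  (forall e : R, 0 < e ->
    exists n0, forall n, (n0 <= n)%N -> nm (u n - u n0) <= e) ->
  exists l, u @ \oo --> l.
Proof.
move=> cu.
have /cauchyR_cvg cRe (e : R) : 0 < e ->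
    exists n0, forall n, (n0 <= n)%N -> `|complex.Re (u n) - complex.Re (u n0)| <= e.
  move=> /cu[n0 hn]; exists n0 => n /hn; apply: le_trans.
  by rewrite -raddfB; exact: normc_Re_le.
have /cauchyR_cvg cIm (e : R) : 0 < e ->
    exists n0, forall n, (n0 <= n)%N -> `|complex.Im (u n) - complex.Im (u n0)| <= e.
  move=> /cu[n0 hn]; exists n0 => n /hn; apply: le_trans.
  by rewrite -raddfB; exact: normc_Im_le.
move/cvg_ex: cRe => [a /cvgrPdist_le ca]; move/cvg_ex: cIm => [b /cvgrPdist_le cb].
exists (a +i* b); apply/cvgC_normcP => e e0.
have e20 : 0 < e / 2 by rewrite divr_gt0.
have [n0 _ hn] := ca _ e20; have [n1 _ hm] := cb _ e20.
exists (maxn n0 n1) => n; rewrite geq_max => /andP[/hn ha /hm hb].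
apply: le_trans (normc_le_ReIm _) _; rewrite !raddfB /= distrC [X in _ + X]distrC.
by rewrite [e]splitr lerD.
Qed.

Lemma natr_ex_ge (x : R) (m : nat) : exists2 n, (m <= n)%N & x <= n%:R.
Proof.
exists (maxn m (Num.truncn x).+1); first exact: leq_maxl.
apply: le_trans (ltW (Num.Theory.truncnS_gt x)) _.
by rewrite ler_nat leq_maxr.
Qed.

(* Telescoping gives |u n - u m| <= 2 K |u m| (1/m - 1/n) once m >= 4 K. *)
Lemma ratio_cvg_neq0 u (K : R) (n0 : nat) : (0 < n0)%N -> 0 <= K ->
  (forall n, (n0 <= n)%N -> u n != 0) ->
  (forall n, (n0 <= n)%N ->
     nm (u n.+1 - u n) <= K * (n%:R^-1 - n.+1%:R^-1) * nm (u n)) ->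
  exists2 l, l != 0 & u @ \oo --> l.
Proof.
move=> n00 K0 u0 du.
have [m0 nm0 Km0] := natr_ex_ge (4 * K) n0.
have dist m n : (m0 <= m)%N -> (m <= n)%N ->
    nm (u n - u m) <= 2 * K * nm (u m) * (m%:R^-1 - n%:R^-1).
  move=> m0m; have mpos : 0 < m%:R :> R.
    by rewrite ltr0n (leq_trans _ m0m) // (leq_trans n00).
  have Km : K / m%:R <= 1 / 4.
    have : m0%:R <= m%:R :> R by rewrite ler_nat.
    by rewrite ler_pdivrMr //; lra.
  elim: n => [|n IHn]; first by rewrite leqn0 => /eqP ->; rewrite !subrr mulr0 ComplexField.Normc.normc0.
  rewrite leq_eqVlt => /orP[/eqP <-|]; first by rewrite !subrr mulr0 ComplexField.Normc.normc0.
  rewrite ltnS => mn; have {}IHn := IHn mn.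
  have npos : 0 < n%:R :> R by apply: lt_le_trans mpos _; rewrite ler_nat.
  have := du n (leq_trans nm0 (leq_trans m0m mn)).
  have t1 := le_normcD (u n.+1 - u n) (u n - u m); rewrite subrKA in t1.
  have t2 := le_normcD (u n - u m) (u m); rewrite subrK in t2.
  have d0 : 0 <= n%:R^-1 - n.+1%:R^-1 :> R.
    by rewrite subr_ge0 lef_pV2 ?posrE ?ltr0Sn // ler_nat.
  have ni : 0 < n%:R^-1 :> R by rewrite invr_gt0.
  have a0 := normc_ge0 (u m).
  (* By induction [u n] is within [nm (u m) / 2] of [u m], since [K / m <= 1 / 4]. *)
  have b2 : nm (u n) <= 2 * nm (u m).
    have : K * nm (u m) * (m%:R^-1 - n%:R^-1) <= 1 / 4 * nm (u m).
      apply: le_trans (_ : K / m%:R * nm (u m) <= _); last by rewrite ler_wpM2r.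
      rewrite mulrAC ler_wpM2r // mulrBr gerBl mulr_ge0 // ltW //.
    lra.
  have := ler_wpM2l (mulr_ge0 K0 d0) b2.
  set x := nm (u n); set y := nm (u m) in IHn t1 b2 *.
  set d := n%:R^-1 in IHn d0 *; set d' := n.+1%:R^-1 in d0 *; set d'' := m%:R^-1 in IHn *.
  move=> b3 b4; apply: le_trans t1 _.
  have -> : 2 * K * y * (d'' - d') = K * (d - d') * (2 * y) + 2 * K * y * (d'' - d) by ring.
  by apply: lerD => //; apply: le_trans b4 _.
have m00 : 0 < m0%:R :> R by rewrite ltr0n (leq_trans n00).
have B0 : 0 < nm (u m0) by rewrite normc_gt0 u0.
have far n : (m0 <= n)%N -> nm (u n - u m0) <= nm (u m0) / 2.
  move=> mn; apply: le_trans (dist _ _ (leqnn _) mn) _.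
  have -> : nm (u m0) / 2 = 2 * (1 / 4) * nm (u m0) by field.
  rewrite mulrAC ler_wpM2r ?(ltW B0) // -mulrA ler_wpM2l //.
  apply: le_trans (_ : K / m0%:R <= _).
    by rewrite mulrBr gerBl mulr_ge0 // invr_ge0.
  by rewrite ler_pdivrMr //; lra.
have [l ul] : exists l, u @ \oo --> l.
  apply: cauchyC_cvg => e e0.
  have [m mm0 hm] := natr_ex_ge (4 * K * nm (u m0) / e) m0.
  have m_gt0 : 0 < m%:R :> R by apply: lt_le_trans m00 _; rewrite ler_nat.
  exists m => n mn; apply: le_trans (dist _ _ mm0 mn) _.
  have um : nm (u m) <= 2 * nm (u m0).
    by have := le_normcD (u m - u m0) (u m0); rewrite subrK; have := far m mm0; lra.
  apply: le_trans (_ : 2 * K * nm (u m) / m%:R <= _).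
    by rewrite mulrBr gerBl !mulr_ge0 ?normc_ge0 // invr_ge0.
  rewrite ler_pdivrMr //; rewrite ler_pdivrMr // in hm.
  by rewrite [_ * m%:R]mulrC (le_trans _ hm) //; have := ler_wpM2l K0 um; lra.
(* By [far] the tail has modulus at least half of [nm (u m0)], whereas a zero limit would push it
   below a third. *)
exists l => //; apply/eqP => l0; move/cvgC_normcP: ul => /(_ (nm (u m0) / 3)).
case=> [|n1 hn]; first by rewrite divr_gt0.
have := hn (maxn m0 n1) (leq_maxr _ _); have := far (maxn m0 n1) (leq_maxl _ _).
rewrite l0 subr0; set n := maxn m0 n1.
have := le_normcD (u m0 - u n) (u n); rewrite subrK normc_distC.
lra.
Qed.

End ComplexSequences.

(** * Gamma function and binomial coefficients *)

Section GammaFunction.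
Local Open Scope complex_scope.
Local Open Scope ring_scope.
Variable R : realType.
Local Notation C := (Cplx R).
Local Notation nm := (@ComplexField.Normc.normc R).
Implicit Types (z v w : C).

Definition Euler z (n : nat) : C :=
  n`!%:R * cexp (z * (ln n%:R)%:C) / \prod_(0 <= j < n.+1) (z + j%:R).

Definition nonpole z := forall j : nat, z + j%:R != 0.

Lemma nonpole_prod z n : nonpole z -> \prod_(0 <= j < n) (z + j%:R) != 0.
Proof. by move=> hz; rewrite prodf_seq_neq0; apply/allP => j _ /=; exact: hz. Qed.

Lemma Euler_neq0 z n : nonpole z -> Euler z n != 0.
Proof.
move=> hz; apply: mulf_neq0; last by rewrite invr_eq0 nonpole_prod.
by apply: mulf_neq0; rewrite ?cexp_neq0 // pnatr_eq0 -lt0n fact_gt0.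
Qed.

(** Both bounds are instances of [ln (1 + x) <= x], at [x = -1/(n+1)] and [x = 1/n]. *)
Lemma ln_succ_bounds (n : nat) : (0 < n)%N ->
  (n.+1%:R : R)^-1 <= ln n.+1%:R - ln n%:R <= (n%:R : R)^-1.
Proof.
move=> n0; have np : 0 < n%:R :> R by rewrite ltr0n.
have sp : 0 < n.+1%:R :> R by rewrite ltr0n.
have sE : n.+1%:R = n%:R + 1 :> R by rewrite -natr1.
apply/andP; split.
  rewrite -opprB lerNr -ln_div ?posrE //.
  have -> : n%:R / n.+1%:R = 1 + - n.+1%:R^-1 :> R.
    by rewrite sE; field; rewrite -sE gt_eqF.
  apply: le_ln1Dx; rewrite ltrN2 invf_lt1 // ltr1n ltnS //.
rewrite -ln_div ?posrE //.
have -> : n.+1%:R / n%:R = 1 + n%:R^-1 :> R.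
  by rewrite sE; field; rewrite gt_eqF.
by apply: le_ln1Dx; rewrite (lt_trans (ltrN10 _)) // invr_gt0.
Qed.

(** The quotient of successive terms is [(n+1) exp(z t) / (z+n+1)] with [t = ln(n+1) - ln n].
    Subtracting 1 leaves a bracket that is a quadratic remainder up to replacing [t] by
    [1/(n+1)]. *)
Lemma Euler_succ z n : nonpole z -> (0 < n)%N ->
  (Euler z n.+1 - Euler z n) * (z + n.+1%:R) =
  n.+1%:R * (cexp (z * (ln n.+1%:R - ln n%:R)%:C) - 1 - z / n.+1%:R) * Euler z n.
Proof.
move=> hz n0; rewrite /Euler factS natrM big_nat_recr //=.
have -> : z * (ln n.+1%:R)%:C = z * (ln n.+1%:R - ln n%:R)%:C + z * (ln n%:R)%:C.
  by rewrite -mulrDr -rmorphD subrK.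
rewrite cexpD; set P := \prod_(_ <= _ < _) _; set E := cexp _; set E' := cexp _.
have P0 : P != 0 by exact: nonpole_prod.
have s0 : (n.+1%:R : C) != 0 by rewrite pnatr_eq0.
move: s0 (hz n.+1); move: (n.+1%:R : C) => s s0 zs.
by field; rewrite P0 zs s0.
Qed.

Lemma Euler_cvg z : nonpole z -> exists2 l, l != 0 & Euler z @ \oo --> l.
Proof.
move=> hz; have Z0 := normc_ge0 z.
have [n0 n00 zn0] := natr_ex_ge (2 * nm z) 1.
(* The bound [16 |z|^2 + |z|] on the bracket, per unit of [1/n - 1/(n+1)], is doubled because
   [|z+n+1| >= (n+1)/2] once [n >= 2 |z|]. *)
apply: (ratio_cvg_neq0 (K := 32 * nm z ^+ 2 + 2 * nm z) n00).
- by have := sqr_ge0 (nm z); lra.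
- by move=> n _; exact: Euler_neq0.
move=> n nn0; have n_gt0 : (0 < n)%N := leq_trans n00 nn0.
have np : 0 < n%:R :> R by rewrite ltr0n.
have sp : 0 < n.+1%:R :> R by rewrite ltr0n.
have zn : 2 * nm z <= n%:R by apply: le_trans zn0 _; rewrite ler_nat.
have sn : n.+1%:R = n%:R + 1 :> R by rewrite -natr1.
have /andP[] := ln_succ_bounds n_gt0; set t := _ - _ => t1 t2.
have := Euler_succ hz n_gt0; rewrite -/t.
move: (Euler z n) => e; move: (Euler z n.+1 - e) => x; have E0 := normc_ge0 e.
pose y0 := cexp (z * t%:C) - 1 - z / n.+1%:R; rewrite -/y0.
have [y yE] : exists y, y = y0 by exists y0.
rewrite -yE => /(congr1 nm).
rewrite !ComplexField.Normc.normcM normc_nat => xy.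
set a := n%:R^-1 in t2 *; set b := n.+1%:R^-1 in t1 *.
have b0 : 0 < b by rewrite invr_gt0.
have ab : a - b = a * b by rewrite /a /b sn; field; rewrite -sn !gt_eqF.
have a2b : a <= 2 * b.
  rewrite /a /b ler_pdivlMr // mulrC ler_pdivrMr //.
  have : 1 <= n%:R :> R by rewrite ler1n.
  by lra.
have nt : nm (z * t%:C) = nm z * t.
  by rewrite ComplexField.Normc.normcM normc_real ger0_norm // (le_trans (ltW b0)).
have yle : nm y <= (16 * nm z ^+ 2 + nm z) * (a - b).
  have -> : y = (cexp (z * t%:C) - 1 - z * t%:C) + z * (t - b)%:C.
    have -> : (t - b)%:C = t%:C - n.+1%:R^-1 :> C.
      by rewrite rmorphB /b (fmorphV (real_complex R)) (rmorph_nat (real_complex R)).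
    by rewrite yE /y0; ring.
  apply: le_trans (le_normcD _ _) _.
  have h1 : nm (z * t%:C) <= 1 / 2.
    rewrite nt; apply: le_trans (ler_wpM2l Z0 t2) _.
    by rewrite /a ler_pdivrMr //; lra.
  have := cexp_sub1z_le h1; rewrite nt ComplexField.Normc.normcM normc_real.
  rewrite ger0_norm ?subr_ge0 // exprMn.
  (* From [t <= a] and [a <= 2 b], the square of [t] is at most [2 a b], which telescopes. *)
  have t20 : t ^+ 2 <= 2 * (a - b).
    by rewrite ab; nra.
  have h3 := ler_wpM2l (sqr_ge0 (nm z)) t20.
  have h4 : nm z * (t - b) <= nm z * (a - b) by rewrite ler_wpM2l // lerB.
  by lra.
have den : n.+1%:R / 2 <= nm (z + n.+1%:R).
  have := le_normcD (z + n.+1%:R) (- z); rewrite addrAC subrr add0r normcN normc_nat.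
  lra.
have x0 := normc_ge0 x.
have : nm x * (n.+1%:R / 2) <= n.+1%:R * nm y * nm e.
  by rewrite -xy ler_wpM2l.
have -> : nm x * (n.+1%:R / 2) = n.+1%:R * (nm x / 2) by ring.
rewrite -mulrA ler_pM2l // => h.
have := ler_wpM2r E0 yle; lra.
Qed.

(** This is the factor between Euler's terms at [z + 1] and [z] times those at [z]. It differs from
    1 by [-(c+1)/(c+n+1)]. *)
Lemma cvgC_div_succ (c : C) :
  (fun n : nat => n%:R / (c + n.+1%:R)) @ \oo --> (1 : C).
Proof.
apply/cvgC_normcP => e e0; have c0 := normc_ge0 (c + 1).
have [n0 _ hn] := natr_ex_ge (nm (c + 1) + nm (c + 1) / e + 1) 1.
exists n0 => n nn0.
have ce : 0 <= nm (c + 1) / e by rewrite divr_ge0 // ltW.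
have nb : nm (c + 1) + nm (c + 1) / e + 1 <= n%:R.
  by apply: le_trans hn _; rewrite ler_nat.
have d0 : nm (c + 1) / e < nm (c + n.+1%:R).
  have := le_normcD (c + n.+1%:R) (- (c + 1)).
  have -> : c + n.+1%:R - (c + 1) = n%:R by rewrite -natr1; ring.
  by rewrite normcN normc_nat; lra.
have dn : c + n.+1%:R != 0 by rewrite -normc_gt0 (le_lt_trans ce).
have -> : n%:R / (c + n.+1%:R) - 1 = - (c + 1) / (c + n.+1%:R).
  by move: dn; rewrite -natr1 => dn; field.
rewrite ComplexField.Normc.normcM normcN ComplexField.Normc.normcV.
rewrite ler_pdivrMr ?normc_gt0 // mulrC -ler_pdivrMr //.
exact: ltW.
Qed.

Lemma Gamma_cvg z : nonpole z -> Euler z @ \oo --> Gamma z.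
Proof.
by move=> /Euler_cvg[l _ hl]; rewrite /Gamma -/(Euler z) (norm_cvg_lim hl).
Qed.

Lemma Gamma_neq0 z : nonpole z -> Gamma z != 0.
Proof.
by move=> /Euler_cvg[l l0 hl]; rewrite /Gamma -/(Euler z) (norm_cvg_lim hl).
Qed.

Lemma nonpoleS z : nonpole z -> nonpole (z + 1).
Proof. by move=> hz j; rewrite -addrA nat1r hz. Qed.

Lemma Euler_shift z n : nonpole z -> (0 < n)%N ->
  Euler (z + 1) n = n%:R / (z + n.+1%:R) * (z * Euler z n).
Proof.
move=> hz n0; rewrite /Euler.
have -> : (z + 1) * (ln n%:R)%:C = z * (ln n%:R)%:C + (ln n%:R)%:C by rewrite mulrDl mul1r.
rewrite cexpD cexp_ln ?ltr0n // (rmorph_nat (real_complex R)).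
have -> : \prod_(0 <= j < n.+1) (z + 1 + j%:R) =
    \prod_(0 <= j < n) (z + j.+1%:R) * (z + n.+1%:R).
  rewrite big_nat_recr //= -addrA nat1r; congr (_ * _).
  by apply: eq_bigr => j _; rewrite -addrA nat1r.
rewrite big_nat_recl // addr0.
have := hz 0; rewrite addr0 => z0; have zn := hz n.+1.
have : \prod_(0 <= j < n) (z + j.+1%:R) != 0.
  by rewrite prodf_seq_neq0; apply/allP => j _ /=; exact: hz.
move: (\prod_(_ <= _ < _) _) zn; move: (n.+1%:R : C) => s P zn P0.
by field; rewrite P0 z0 zn.
Qed.

Lemma GammaS z : nonpole z -> Gamma (z + 1) = z * Gamma z.
Proof.
move=> hz; apply: norm_cvg_lim.
have : (fun n : nat => n%:R / (z + n.+1%:R) * (z * Euler z n)) @ \oo --> 1 * (z * Gamma z).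
  apply: cvgM; first exact: cvgC_div_succ.
  by apply: cvgM; [exact: cvg_cst|exact: Gamma_cvg].
rewrite mul1r; apply: cvg_trans; apply: near_eq_cvg; exists 1 => // n /= n0.
exact/esym/Euler_shift.
Qed.

(** At 1 Euler's terms are [n / (n+1)]. *)
Lemma Gamma1 : Gamma (1 : C) = 1.
Proof.
apply: norm_cvg_lim; have := cvgC_div_succ 0.
apply: cvg_trans; apply: near_eq_cvg; exists 1 => // n /= n0.
rewrite mul1r cexp_ln ?ltr0n // rmorph_nat add0r.
have -> : \prod_(0 <= j < n.+1) (1 + j%:R) = (n.+1)`!%:R :> C.
  by rewrite fact_prod natr_prod big_add1 /=; apply: eq_bigr => j _; rewrite nat1r.
have f0 : (n`!%:R : C) != 0 by rewrite pnatr_eq0 -lt0n fact_gt0.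
have s0 : (n.+1%:R : C) != 0 by rewrite pnatr_eq0.
rewrite factS natrM; move: (n.+1%:R : C) s0 => s s0.
by field; rewrite f0 s0.
Qed.

Lemma nonpole_nat n : nonpole (n.+1%:R : C).
Proof. by move=> j; rewrite -natrD pnatr_eq0. Qed.

Lemma Gamma_nat n : Gamma (n%:R + 1 : C) = n`!%:R.
Proof.
elim: n => [|n IHn]; first by rewrite add0r Gamma1 fact0.
by rewrite GammaS ?natr1 -?[in Gamma _]natr1 ?IHn ?factS ?natrM //; exact: nonpole_nat.
Qed.

(** The falling factorial; divided by [j!] it is the binomial coefficient binom(w, j). *)
Definition ffactC (w : C) (j : nat) : C := \prod_(0 <= i < j) (w - i%:R).

(** The functional equation is iterated [j] times; avoiding the poles at the lowest argument avoids
    them at all higher ones. *)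
Lemma Gamma_ffact v j : nonpole (v + 1 - j%:R) ->
  Gamma (v + 1) = ffactC v j * Gamma (v + 1 - j%:R).
Proof.
elim: j => [|j IHj] hv; first by rewrite /ffactC big_geq // mul1r subr0.
have vE : v + 1 - j%:R = v + 1 - j.+1%:R + 1 by rewrite -natr1; ring.
rewrite IHj vE; last exact: nonpoleS.
rewrite GammaS // /ffactC big_nat_recr //= mulrA; congr (_ * _ * _).
by rewrite -natr1; ring.
Qed.

Lemma ffactC_cvg (F : set_system C) (FF : Filter F) w j : F --> w ->
  ffactC v j @[v --> F] --> ffactC w j.
Proof.
move=> Fw; elim: j => [|j IHj].
  have ffact0 v : ffactC v 0 = 1 by rewrite /ffactC big_geq.
  by rewrite ffact0; under eq_cvg do rewrite ffact0; exact: (cvg_cst (1 : C)).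
have ffactS v : ffactC v j.+1 = ffactC v j * (v - j%:R).
  by rewrite /ffactC big_nat_recr.
rewrite ffactS; under eq_cvg do rewrite ffactS.
apply: cvgM; first exact: IHj.
apply: cvgB; first exact: Fw.
exact: cvg_cst.
Qed.

Lemma normc_intr_ge1 (a b : int) : a != b -> 1 <= `|a%:~R - b%:~R : C|.
Proof.
move=> ab; rewrite -rmorphB -intr_norm -[1]/(1%:~R) ler_int.
by rewrite -gtz0_ge1 normr_gt0 subr_eq0.
Qed.

(* At most one integer lies within 1/2 of w. *)
Lemma dnbhs_nonint w : \forall v \near w^', forall a : int, v != a%:~R.
Proof.
have [[a [aw aw2]]|noa] :=
    pselect (exists a : int, a%:~R != w /\ `|w - a%:~R| < 1 / 2).
  have d0 : 0 < `|w - a%:~R| by rewrite normr_gt0 subr_eq0 eq_sym.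
  apply/nbhs_ballP; exists `|w - a%:~R| => //= v.
  rewrite /ball /= => vw vnw b; apply/eqP => vb; subst v.
  have [ba|ba] := eqVneq a b; first by rewrite ba ltxx in vw.
  have := normc_intr_ge1 ba.
  have -> : (a%:~R - b%:~R : C) = (w - b%:~R) - (w - a%:~R) by ring.
  apply/negP; rewrite -real_ltNge ?ger0_real ?normr_ge0 ?ler01 //.
  apply: le_lt_trans (ler_normB _ _) _; rewrite [1 in ltRHS]splitr ltrD //.
  exact: lt_trans vw aw2.
apply/nbhs_ballP; exists (1 / 2); first by rewrite /= divr_gt0.
move=> v vw vnw b; apply/eqP => vb; subst v; apply: noa; exists b; split=> //.
Qed.

(** Near [w] but off the integers the Gamma quotient equals a polynomial in [v], so the limit over
    punctured neighbourhoods is the value of that polynomial at [w]. *)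
Lemma CcoefE (a : C) (l m : nat) w :
  Ccoef a l m w =
  if (l <= m)%N then a ^- (m - l) * (ffactC w (m - l) / (m - l)`!%:R) else 0.
Proof.
rewrite /Ccoef; case: (ltngtP l m) => [lm|//|->]; last first.
  by rewrite subnn fact0 /ffactC big_geq // expr0 invr1 !mul1r ?invr1.
set j := (m - l)%N; apply: norm_cvg_lim.
have : (fun v => a ^- j * (ffactC v j / j`!%:R)) @ w^' -->
    a ^- j * (ffactC w j / j`!%:R).
  apply: cvgM; first exact: cvg_cst.
  apply: cvgM; last exact: cvg_cst.
  by apply: ffactC_cvg; exact: nbhs_dnbhs.
apply: cvg_trans; apply: near_eq_cvg; near=> v.
have vint : forall b : int, v != b%:~R by near: v; exact: dnbhs_nonint.
have mlE : m%:R - l%:R = j%:R :> C by rewrite /j natrB // ltnW.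
have -> : v + 1 - m%:R + l%:R = v + 1 - j%:R by rewrite -mlE; ring.
(* A pole at [v + 1 - j] would make [v] an integer. *)
have np : nonpole (v + 1 - j%:R).
  move=> i; apply/eqP => e; have /eqP := vint (j%:Z - 1 - i%:Z); apply.
  by rewrite !rmorphB /= -!pmulrn; apply/eqP; rewrite -subr_eq0 -e; apply/eqP; ring.
rewrite mlE Gamma_nat (Gamma_ffact np).
have G0 := Gamma_neq0 np; have f0 : (j`!%:R : C) != 0 by rewrite pnatr_eq0 -lt0n fact_gt0.
by rewrite -mulf_div mulrA; set q := a ^- j; field; rewrite G0 f0.
Unshelve. all: by end_near. Qed.

(** After extracting [ffactC w j], this is [w + 1 = (w - j) + (j + 1)]. *)
Lemma ffactC_pascal w j :
  ffactC (w + 1) j.+1 / j.+1`!%:R = ffactC w j.+1 / j.+1`!%:R + ffactC w j / j`!%:R.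
Proof.
have f0 : (j`!%:R : C) != 0 by rewrite pnatr_eq0 -lt0n fact_gt0.
have s0 : (j.+1%:R : C) != 0 by rewrite pnatr_eq0.
have -> : ffactC (w + 1) j.+1 = (w + 1) * ffactC w j.
  rewrite /ffactC big_nat_recl // subr0; congr (_ * _).
  by apply: eq_bigr => i _; rewrite -natr1; ring.
rewrite {2}/ffactC big_nat_recr //= -/(ffactC w j) factS natrM.
have jE : (j.+1%:R : C) = j%:R + 1 by rewrite -natr1.
by rewrite jE in s0 *; field; rewrite f0 s0.
Qed.

(** Pascal's rule; the factor [a^-1] makes up for the smaller power of [a^-1] in row [l.+1]. On and
    below the diagonal the second term is zero and the first is constant. *)
Lemma Ccoef_succ (a : C) (l m : nat) w : a != 0 ->
  Ccoef a l m (w + 1) = Ccoef a l m w + a^-1 * Ccoef a l.+1 m w.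
Proof.
move=> a0; rewrite !CcoefE; case: (ltngtP l m) => [lm|lm|->].
- have -> : (m - l = (m - l.+1).+1)%N by rewrite subnSK.
  by rewrite ffactC_pascal mulrDr exprS invfM; congr (_ + _); rewrite mulrA.
- by rewrite mulr0 addr0.
- by rewrite mulr0 addr0 subnn /ffactC !big_geq.
Qed.

End GammaFunction.

Lemma mul_castmx (K : pzSemiRingType) (m m' p : nat) (e : m = m')
    (M : 'M[K]_m) (z : 'M[K]_(m, p)) :
  castmx (e, e) M *m castmx (e, erefl p) z = castmx (e, erefl p) (M *m z).
Proof. by case: _ / e; rewrite !castmx_id. Qed.

Lemma mxcolE_Rank (T : Type) (p q : nat) (k : 'I_p -> nat)
    (B : forall i, 'M[T]_(k i, q)) i (s : 'I_(k i)) t :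
  (\mxcol_j B j) (@tagnat.Rank _ k i s) t = B i s t.
Proof. by rewrite -[in RHS](mxcolK B i) !mxE. Qed.

(** * Solutions in Jordan coordinates *)

Section JordanChains.
Variable R : realType.
Local Notation C := (Cplx R).

(** Letting [g] run over all naturals with [g n = 0] treats the last row, which has no superdiagonal
    entry, like the others. *)
Lemma Jordan_sum n (a : C) (l : 'I_n) (g : nat -> C) : g n = 0 ->
  \sum_(t < n) Jordan_block n a l t * g t = a * g l + g l.+1.
Proof.
move=> gn; under eq_bigr => t _ do rewrite mxE mulrDl.
rewrite big_split /=; congr (_ + _).
  rewrite (bigD1 l) //= eqxx mulr1n big1 ?addr0 // => t tl.
  by rewrite eq_sym (negPf tl) mulr0n mul0r.
have [ln|nl] := ltnP l.+1 n.
  rewrite (bigD1 (Ordinal ln)) //= eqxx mul1r big1 ?addr0 // => t tl.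
  case: eqP => [e|]; last by rewrite mul0r.
  by case/eqP: tl; apply/val_inj.
have ln : l.+1 = n by apply/anti_leq/andP; split; [exact: ltn_ord|exact: nl].

rewrite ln gn big1 // => t _; case: eqP => [e|]; last by rewrite mul0r.
by have := ltn_ord t; rewrite -e ltnn.
Qed.

Definition Cmat n (a w : C) : 'M[C]_n := \matrix_(l, m) Ccoef a l m w.

Lemma Cmat_succ n (a w : C) : a != 0 ->
  a *: Cmat n a (w + 1) = Jordan_block n a *m Cmat n a w.
Proof.
move=> a0; apply/matrixP => l m.
rewrite [LHS]mxE [X in _ * X]mxE Ccoef_succ // [RHS]mxE.
under [RHS]eq_bigr => t _ do rewrite [X in _ * X]mxE.
rewrite (Jordan_sum a l (g := fun t => Ccoef a t m w)) => [|].
  by rewrite mulrDr mulVKf.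
by rewrite CcoefE leqNgt ltn_ord.
Qed.

Lemma Cmat_unit n (a w : C) : Cmat n a w \in unitmx.
Proof.
rewrite unitmxE -det_tr det_trig.
  rewrite big1 ?unitr1 // => i _; rewrite !mxE CcoefE leqnn subnn expr0 invr1 mul1r.
  by rewrite /ffactC big_geq // mulr1.
by apply/is_trig_mxP => i j ij; rewrite !mxE CcoefE leqNgt ij.
Qed.

Lemma cpowS (L : C -> C) (a w : C) : log_branch L -> a != 0 ->
  cpow L a (w + 1) = a * cpow L a w.
Proof. by move=> hL a0; rewrite /cpow mulrDl mul1r cexpD hL.2 // mulrC. Qed.

Lemma cpow_neq0 (L : C -> C) (a w : C) : cpow L a w != 0.
Proof. exact: cexp_neq0. Qed.

Variables (N r : nat) (k : 'I_r.+1 -> nat) (lam : 'I_r.+1 -> C) (L : C -> C).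
Hypotheses (hk : (\sum_i k i)%N = (N + 1)%N) (hL : log_branch L).
Hypothesis hkpos : forall i, (0 < k i)%N.
Local Notation lamr := (lam ord_max).
Local Notation last := (rshift N (ord0 : 'I_1)).
Local Notation D := (castmx (hk, hk) (\mxdiag_i Jordan_block (k i) (lam i))).

Definition glue (B : forall i, 'cV[C]_(k i)) : 'cV[C]_(N + 1) :=
  castmx (hk, erefl 1%N) (\mxcol_i B i).

Definition blockof (z : 'cV[C]_(N + 1)) (i : 'I_r.+1) : 'cV[C]_(k i) :=
  submxcol (castmx (esym hk, esym (erefl 1%N)) z) i.

Lemma blockofK z : glue (blockof z) = z.
Proof. by rewrite /glue submxcolK castmxKV. Qed.

Lemma glueK B i : blockof (glue B) i = B i.
Proof. by rewrite /blockof /glue castmxK mxcolK. Qed.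

Lemma D_glue B : D *m glue B = glue (fun i => Jordan_block (k i) (lam i) *m B i).
Proof. by rewrite /glue mul_castmx mul_mxdiag_mxcol. Qed.

Lemma glueZ a B : glue (fun i => a *: B i) = a *: glue B.
Proof. by apply/colP => s; rewrite !(mxE, castmxE). Qed.

Lemma eq_glue B B' : (forall i, B i = B' i) -> glue B = glue B'.
Proof. by move=> e; rewrite /glue; congr castmx; apply/eq_mxcol. Qed.

(** The global rank of an entry is its local index plus the sizes of the earlier blocks, which gives
    [N] here. *)
Lemma glue_last B (l : 'I_(k ord_max)) : l.+1 = k ord_max ->
  glue B last ord0 = B ord_max l ord0.
Proof.
move=> lk; rewrite /glue castmxE /=.
have -> : cast_ord (esym hk) last = @tagnat.Rank _ k ord_max l.
  apply/val_inj/esym; rewrite [LHS]tagnat.RankEsum /=.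
  have e : (\sum_(i < r) k (widen_ord (leqnSn r) i) + l.+1 = N + 1)%N.
    by rewrite lk -hk big_ord_recr.
  have -> : (\sum_(i < r.+1 | (i < @ord_max r)%N) k i = \sum_(i < r) k (widen_ord (leqnSn r) i))%N.
    rewrite [LHS]big_mkcond big_ord_recr /= ltnn addn0; apply: eq_bigr => i _.
    by rewrite ltn_ord.
  by apply/eqP; rewrite -(eqn_add2r 1) addn0 -e -addnA addn1.
by rewrite mxcolE_Rank; congr (B _ _ _); apply: ord1.
Qed.

Lemma last_index : exists l : 'I_(k ord_max), l.+1 = k ord_max.
Proof.
have h : ((k ord_max).-1 < k ord_max)%N by rewrite prednK.
by exists (Ordinal h); rewrite /= prednK.
Qed.

(** The last row of [D] has only its diagonal entry; this determines the normalizing factor of the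
    recurrence. *)
Lemma D_last (z : 'cV[C]_(N + 1)) : (D *m z) last ord0 = lamr * z last ord0.
Proof.
have [l lk] := last_index.
rewrite -(blockofK z) D_glue !(glue_last _ lk) mxE.
pose g t := if insub t is Some s then blockof z ord_max s ord0 else 0.
have gE (t : 'I_(k ord_max)) : blockof z ord_max t ord0 = g t by rewrite /g valK.
under eq_bigr => t _ do rewrite gE.
rewrite Jordan_sum ?gE; last by rewrite /g insubF ?ltnn.
by rewrite lk {2}/g insubF ?ltnn // addr0.
Qed.

(** The first basis vector of block [i] is an eigenvector for [lam i]; eigenvalue zero would
    contradict invertibility. *)
Lemma Jordan_lam_neq0 : D \in unitmx -> forall i, lam i != 0.
Proof.
move=> uD i; apply/eqP => li0.
pose g j t : C := ((j == i :> 'I_r.+1) && (t == 0 :> nat))%:R.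
pose v j : 'cV[C]_(k j) := \col_t g j t.
have Dv : D *m glue v = 0.
  rewrite D_glue -(blockofK 0); apply: eq_glue => j.
  apply/colP => l; rewrite mxE; under eq_bigr => t _ do rewrite [v j _ _]mxE.
  rewrite (Jordan_sum _ _ (g := g j)); last by rewrite /g gtn_eqF ?andbF.
  rewrite {2}/g andbF addr0 !(mxE, castmxE) /g.
  have [ji|_] := eqVneq j i; last by rewrite mulr0.
  have -> : lam j = 0 by rewrite ji.
  by rewrite mul0r.
have : v i = 0.
  rewrite -(glueK v) -[glue v](mulKmx uD) Dv mulmx0.
  by apply/colP => l; rewrite !(mxE, castmxE).
move=> /colP/(_ (Ordinal (hkpos i)))/eqP; rewrite !mxE /g !eqxx.
by rewrite oner_eq0.
Qed.

Section Solutions.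
Hypothesis lam0 : forall i, lam i != 0.

Lemma YblockE (I : periodic_data R k) w i :
  Yblock L lam I w i =
  cpow L (lam i / lamr) w *: (Cmat (k i) (lam i) w *m \col_m I i m w).
Proof.
apply/colP => l; rewrite !mxE; congr (_ * _).
by apply: eq_bigr => m _; rewrite !mxE.
Qed.

(** The last row of the triangular matrix is a unit vector, and the power of the ratio 1 is 1
    because [L 1 = 0]. *)
Lemma Yblock_last (I : periodic_data R k) w (l : 'I_(k ord_max)) :
  l.+1 = k ord_max -> Yblock L lam I w ord_max l ord0 = I ord_max l w.
Proof.
move=> lk; rewrite mxE divff // /cpow hL.1 mulr0 cexp0 mul1r.
rewrite (bigD1 l) //= big1 ?addr0 => [|m ml].
  by rewrite /Ccoef ltnn eqxx mul1r.
rewrite CcoefE leqNgt; have -> : (m < l)%N; last by rewrite mul0r.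
by rewrite ltn_neqAle ml -ltnS lk ltn_ord.
Qed.

(** In each block the power contributes [lam i / lamr] and the step of [Cmat] contributes the
    inverse of [lam i], leaving the common factor [lamr^-1]. *)
Lemma Yvec_succ (I : periodic_data R k) w :
  (forall i l v, I i l (v + 1) = I i l v) ->
  Yvec L lam hk I (w + 1) = lamr^-1 *: (D *m Yvec L lam hk I w).
Proof.
move=> Iper; rewrite D_glue -glueZ; apply: eq_glue => i.
have vE : \col_m I i m (w + 1) = \col_m I i m w by apply/colP => m; rewrite !mxE Iper.
have a0 : lam i / lamr != 0 by rewrite mulf_neq0 ?invr_eq0.
rewrite !YblockE vE.
move: (\col_m I i m w) => v; rewrite (cpowS w hL a0).
move: (cpow L _ w) => c.
rewrite -scalemxAr mulmxA -(Cmat_succ _ _ (lam0 i)) -scalemxAl !scalerA.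
by congr (_ *: _); ring.
Qed.

Section Inversion.
Variables (S : set C) (Y : C -> 'cV[C]_(N + 1)).
Hypothesis hS : forall w, S (w + 1) <-> S w.
Hypothesis Ysucc : forall w, S w -> Y (w + 1) = lamr^-1 *: (D *m Y w).
Hypothesis Ylast : forall w, S w -> Y w last ord0 = 1.

Lemma Yvec_surj : exists2 I : periodic_data R k, admissible I &
  forall w, S w -> Yvec L lam hk I w = Y w.
Proof.
pose c i w := cpow L (lam i / lamr) w.
pose J i w := (c i w)^-1 *: (invmx (Cmat (k i) (lam i) w) *m blockof (Y w) i).
(* Off [S] the data are the constant 1, which respects the normalization; invariance of [S] under
   the shift keeps periodicity. *)
pose I : periodic_data R k := fun i m w => if `[< S w >] then J i w m ord0 else 1.
have YI w i : S w -> Yblock L lam I w i = blockof (Y w) i.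
  move=> Sw; rewrite YblockE.
  have -> : \col_m I i m w = J i w by apply/colP => m; rewrite mxE /I asboolT.
  by rewrite -scalemxAr scalerA divff ?cpow_neq0 // scale1r mulKVmx // Cmat_unit.
have YvI w : S w -> Yvec L lam hk I w = Y w.
  by move=> Sw; rewrite -[RHS]blockofK; apply: eq_glue => i; rewrite YI.
exists I; last exact: YvI.
split=> [i l w|l lk w]; last first.
  have [Sw|nSw] := pselect (S w); last by rewrite /I asboolF.
  by rewrite -(Yblock_last I w lk) (YI w _ Sw) -(glue_last _ lk) blockofK Ylast.
have [Sw|nSw] := pselect (S w); last by rewrite /I !asboolF // hS.
have a0 : lam i / lamr != 0 by rewrite mulf_neq0 ?invr_eq0.
rewrite /I (asboolT ((hS w).2 Sw)) (asboolT Sw); suff -> : J i (w + 1) = J i w by [].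
rewrite /J (Ysucc Sw) /c (cpowS w hL a0).
set u := (X in _ = _ *: X).
have bE : blockof (Y w) i = Cmat (k i) (lam i) w *m u by rewrite mulKVmx ?Cmat_unit.
have -> : blockof (lamr^-1 *: (D *m Y w)) i = (lam i / lamr) *: (Cmat (k i) (lam i) (w + 1) *m u).
  rewrite -[in LHS](blockofK (Y w)) D_glue -glueZ glueK bE mulmxA -(Cmat_succ _ _ (lam0 i)).
  by rewrite -scalemxAl scalerA mulrC.
rewrite -scalemxAr mulKmx ?Cmat_unit // scalerA; congr (_ *: _).
have := cpow_neq0 L (lam i / lamr) w; move: (cpow _ _ _) => q q0.
by field; rewrite q0 !lam0.
Qed.

End Inversion.
End Solutions.
End JordanChains.

(** * Transfer between Jordan coordinates and the functional equation *)

Theorem theorem2 (R : realType) (N n : nat)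
  (Fn V Vinv : ratmap R N) (A U : 'M[Cplx R]_(N + 1))
  (r : nat) (k : 'I_r.+1 -> nat) (lam : 'I_r.+1 -> Cplx R)
  (L : Cplx R -> Cplx R)
  (hk : (\sum_i k i)%N = (N + 1)%N)
  (hn : degree Fn = n)
  (hFn : birational Fn)
  (hV : inverse_ratmaps V Vinv)
  (hA : \det A != 0)
  (hF : ratmap_eq (rapp Fn)
          (rcomp (rapp V) (rcomp (rapp (linfrac A)) (rapp Vinv))))
  (hkpos : forall i, (0 < k i)%N)
  (hU : U \in unitmx)
  (hD : U *m A *m invmx U =
          castmx (hk, hk) (\mxdiag_i Jordan_block (k i) (lam i)))
  (hL : log_branch L) :
  (forall I : periodic_data R k, admissible I ->
     (forall l : 'I_(k ord_max), l.+1 = k ord_max ->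
        forall w, Yblock L lam I w ord_max l ord0 = 1) /\
     (forall w p q,
        obind (rapp V) (ysol L lam hk U I w) = Some p ->
        obind (rapp V) (ysol L lam hk U I (w + 1)) = Some q ->
        rapp Fn p <> None ->
        rapp Fn p = Some q)) /\
  (forall (S : set (Cplx R)) (yt : Cplx R -> 'cV[Cplx R]_N),
     (forall w, S (w + 1) <-> S w) ->
     solution_on S Fn yt ->
     (forall w, S w -> general_position V Vinv U (yt w)) ->
     exists2 I : periodic_data R k, admissible I &
       forall w, S w -> obind (rapp V) (ysol L lam hk U I w) = Some (yt w)).
Proof.
have uA : A \in unitmx by rewrite unitmxE unitfE.
have uD : castmx (hk, hk) (\mxdiag_i Jordan_block (k i) (lam i)) \in unitmx.
  by rewrite -hD !unitmx_mul unitmx_inv hU uA.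
have lam0 := Jordan_lam_neq0 hkpos uD.
split=> [I [Iper Ilast]|S yt hS yt_sol yt_gen].
  split=> [l lk w|w p q]; first by rewrite Yblock_last ?Ilast.
  case E : (ysol _ _ _ _ _ w) => [x|//] /= Vx.
  case E' : (ysol _ _ _ _ _ (w + 1)) => [x'|//] /= Vx'.
  apply: (semiconj_point hV hF Vx _ Vx').
  move/dehomogP: E => [c c0 Yw]; move/dehomogP: E' => [c' c'0].
  (* Conjugating by [U] turns the recurrence into proportionality of [A *m homog x] and
     [homog x']. *)
  rewrite (Yvec_succ hk hL lam0 w Iper) -hD -scalemxAr -!mulmxA mulKmx // Yw.
  rewrite -scalemxAr -rvec_linfrac scalerA => e; apply/rappP.
  have d0 : (lam ord_max)^-1 * c != 0 by rewrite mulf_neq0 ?invr_eq0.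
  exists (((lam ord_max)^-1 * c)^-1 * c'); first by rewrite mulf_neq0 ?invr_eq0.
  by rewrite -scalerA -e scalerA mulVf ?scale1r.
have /choice[X XE] : forall w, exists x, S w ->
    [/\ rapp Vinv (yt w) = Some x, rapp V x = Some (yt w) &
      (U *m homog x) (rshift N ord0) ord0 != 0].
  move=> w; have [Sw|nSw] := pselect (S w); last by exists 0.
  by have [x hx] := yt_gen w Sw; exists x.
pose c w := (U *m homog (X w)) (rshift N ord0) ord0.
pose Y w : 'cV[Cplx R]_(N + 1) := (c w)^-1 *: (U *m homog (X w)).
have Ylast w : S w -> Y w (rshift N ord0) ord0 = 1.
  by move=> /XE[_ _ c0]; rewrite mxE mulVf.
have Ysucc w : S w -> Y (w + 1) = (lam ord_max)^-1 *: (castmx (hk, hk)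
    (\mxdiag_i Jordan_block (k i) (lam i)) *m Y w).
  move=> Sw; have Sw1 := (hS w).2 Sw.
  have [_ Vx c0] := XE w Sw; have [Vq _ c1] := XE _ Sw1.
  have /rappP[b b0 e] := semiconj_inv_point hV uA hF Vx (yt_sol w Sw) Vq.
  have DY : castmx (hk, hk) (\mxdiag_i Jordan_block (k i) (lam i)) *m Y w =
      ((c w)^-1 * b * c (w + 1)) *: Y (w + 1).
    rewrite -hD -scalemxAr -!mulmxA mulKmx // -rvec_linfrac e -scalemxAr.
    by rewrite !scalerA mulfK.
  (* Both [Y w] and [Y (w + 1)] have last coordinate 1, so the unknown proportionality factor must
     be [lam ord_max]. *)
  have := D_last lam hk hkpos (Y w); rewrite DY mxE (Ylast _ Sw1) (Ylast w Sw).
  by rewrite !mulr1 => ->; rewrite scalerA mulVf // scale1r.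
have [I Iadm IE] := Yvec_surj hL lam0 hS Ysucc Ylast.
exists I => // w Sw; have [_ Vx c0] := XE w Sw.
suff -> : ysol L lam hk U I w = Some (X w) by [].
apply/dehomogP; exists (c w)^-1; first by rewrite invr_eq0.
by rewrite IE // -scalemxAr mulKmx.
Qed.
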